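(* Let $K_n^*$ be the complete digraph of order $n\geq 3$. Then $b_I(K_n^* )=n$.
   Context: $K_n^*$ is the digraph on $n$ vertices with both arcs $uv$ and $vu$ for every pair of distinct vertices $u,v$ (the associated digraph of the complete graph $K_n$). An Italian dominating function (IDF) on a digraph $D$ is a function $f:V(D)\to\{0,1,2\}$ such that every vertex $v$ with $f(v)=0$ has at least two in-neighbors $w$ with $f(w)=1$ or at least one in-neighbor $w$ with $f(w)=2$; its weight is $\sum_u f(u)$ and $\gamma_I(D)$ is the minimum weight of an IDF. The Italian bondage number $b_I(D)$ is the minimum number of arcs of $A(D)$ whose removal from $D$ (keeping all vertices) results in a digraph $D'$ with $\gamma_I(D')>\gamma_I(D)$. *)

(* Defs.v *)
From HB Require Import structures.
From mathcomp Require Import all_boot.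

Set Implicit Arguments.
Unset Strict Implicit.
Unset Printing Implicit Defensive.

(* A digraph on a vertex type V is given by its arc set; (u, v) is the arc
   from u to v.  Loops are not excluded by the type, but they play no role in
   the domination condition and complete_digraph has none. *)
Definition digraph (V : finType) := {set V * V}.

Definition in_neighbors (V : finType) (A : digraph V) (v : V) : {set V} :=
  [set w | (w, v) \in A].

Definition italian_dominating (V : finType) (A : digraph V)
    (f : {ffun V -> 'I_3}) : bool :=
  [forall v, (f v == 0 :> nat) ==>
     ((2 <= #|[set w in in_neighbors A v | f w == 1 :> nat]|)
   || (1 <= #|[set w in in_neighbors A v | f w == 2 :> nat]|))].

Definition weight (V : finType) (f : {ffun V -> 'I_3}) : nat := \sum_v f v.

(* The starting point of an [arg min] must satisfy the constraint for the
   result to be meaningful; the constant function 2 always does. *)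
Definition const2 (V : finType) : {ffun V -> 'I_3} := [ffun=> ord_max].

Lemma const2_italian_dominating (V : finType) (A : digraph V) :
  italian_dominating A (const2 V).
Proof. by apply/forallP => v; rewrite ffunE. Qed.

Definition italian_domination_number (V : finType) (A : digraph V) : nat :=
  weight [arg min_(f < const2 V | italian_dominating A f) weight f].

Definition italian_bondage_set (V : finType) (A : digraph V)
    (B : {set V * V}) : bool :=
  (B \subset A)
  && (italian_domination_number A < italian_domination_number (A :\: B)).

(* None when no removal of arcs increases the Italian domination number. *)
Definition italian_bondage_number (V : finType) (A : digraph V) : option nat :=
  if [pick B | italian_bondage_set A B] is Some B0
  then Some #|[arg min_(B < B0 | italian_bondage_set A B) #|B|]|
  else None.

Definition complete_digraph (n : nat) : digraph 'I_n :=
  [set a : 'I_n * 'I_n | a.1 != a.2].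

(* Main.v *)
Require Import Defs.
From HB Require Import structures.
From mathcomp Require Import all_boot.

(** The domination number of the complete digraph is 2, and a spanning vertex
    (one with arcs to all the others) suffices to reach it; hence a bondage set
    must contain an arc out of every vertex.  Conversely, remove the arcs of
    the Hamiltonian cycle i -> i + 1: if f is Italian dominating of weight at
    most 2, every vertex of value 0 receives an arc from the whole support of
    f, so this support is closed under i -> i + 1 and f has weight at
    least 3. *)

(** Two in-neighbors of value 1 and one of value 2 both contribute 2, so the two alternatives of the
    domination condition merge into one inequality. *)
Lemma dominating_in_weight (V : finType) (A : digraph V) f v :
  italian_dominating A f -> f v = 0 :> nat ->
  2 <= \sum_(w in in_neighbors A v) f w.
Proof.
move=> /forallP/(_ v) /[swap] -> /= /orP[ones|].
  apply: (leq_trans ones); rewrite -sum1_card big_mkcond [leqRHS]big_mkcond.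
  apply: leq_sum => w _; rewrite inE.
  by case: ifP => // /andP[-> /eqP ->].
rewrite card_gt0 => /set0Pn[w]; rewrite inE => /andP[wA /eqP fw].
by rewrite (bigD1 w) //= fw.
Qed.

(** The in-neighbors of [v] already carry weight 2; a vertex [u] of positive value outside them
    would raise the total to 3. *)
Lemma dominating_support_arc (V : finType) (A : digraph V) f u v :
  italian_dominating A f -> weight f <= 2 ->
  0 < f u -> f v = 0 :> nat -> (u, v) \in A.
Proof.
move=> fA f2 fu fv; apply/negPn/negP => uvA.
have := dominating_in_weight _ _ _ _ fA fv; apply/negP; rewrite -ltnNge.
apply: leq_trans f2; rewrite /weight [leqRHS](bigID (mem (in_neighbors A v))) /=.
by rewrite -[X in X < _]addn0 ltn_add2l (bigD1 u) ?inE //= addn_gt0 fu.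
Qed.

Lemma dominating_weight_ge2 (V : finType) (A : digraph V) f :
  1 < #|V| -> italian_dominating A f -> 2 <= weight f.
Proof.
move=> V2 fA; have [/existsP[v /eqP fv]|] := boolP [exists v, f v == 0 :> nat].
  apply: (leq_trans (dominating_in_weight _ _ _ _ fA fv)).
  by rewrite /weight [leqRHS](bigID (mem (in_neighbors A v))) leq_addr.
rewrite negb_exists => /forallP f0; apply: (leq_trans V2).
by rewrite -sum1_card; apply: leq_sum => v _; rewrite lt0n.
Qed.

Lemma italian_domination_number_min (V : finType) (A : digraph V) f :
  italian_dominating A f -> italian_domination_number A <= weight f.
Proof.
rewrite /italian_domination_number.
by case: arg_minnP => [|g _ gmin /gmin //]; apply: const2_italian_dominating.
Qed.

Lemma italian_domination_number_witness (V : finType) (A : digraph V) :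
  exists2 f, italian_dominating A f & italian_domination_number A = weight f.
Proof.
rewrite /italian_domination_number.
by case: arg_minnP => [|g gA _]; [apply: const2_italian_dominating | exists g].
Qed.

Lemma italian_domination_number_ge2 (V : finType) (A : digraph V) :
  1 < #|V| -> 2 <= italian_domination_number A.
Proof.
move=> V2; have [f fA ->] := italian_domination_number_witness V A.
exact: dominating_weight_ge2 fA.
Qed.

Lemma italian_domination_number_spanning (V : finType) (A : digraph V) u :
  (forall v, v != u -> (u, v) \in A) -> italian_domination_number A <= 2.
Proof.
move=> uA; pose f : {ffun V -> 'I_3} := [ffun v => if v == u then ord_max else ord0].
have fA : italian_dominating A f.
  (* Value 2 at [u] alone dominates every other vertex. *)
  apply/forallP => v; rewrite ffunE; case: (eqVneq v u) => // vu; apply/implyP => _.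
  by apply/orP; right; apply/card_gt0P; exists u; rewrite !inE uA ?ffunE ?eqxx.
apply: (leq_trans (italian_domination_number_min _ _ _ fA)).
rewrite /weight (bigD1 u) //= ffunE eqxx big1 // => v /negbTE vu.
by rewrite ffunE vu.
Qed.

(** The first projection maps [B] onto all vertices: a vertex that is the tail of no removed arc
    would still be spanning and keep the domination number at 2. *)
Lemma bondage_set_card_ge n (B : {set 'I_n * 'I_n}) : 1 < n ->
  italian_bondage_set (complete_digraph n) B -> n <= #|B|.
Proof.
move=> n2 /andP[_ lt]; apply: leq_trans (leq_imset_card fst B).
rewrite -[leqLHS]card_ord -cardsT; apply/subset_leq_card/subsetP => u _.
apply: contraLR lt => uB; rewrite -leqNgt.
apply: (@leq_trans 2); last by apply: italian_domination_number_ge2; rewrite card_ord.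
apply: (italian_domination_number_spanning _ _ u) => v vu.
rewrite !inE /= eq_sym vu andbT; apply: contra uB => uvB.
by apply/imsetP; exists (u, v).
Qed.

Definition cycle_arcs n : digraph 'I_n := [set (i, ordS i) | i : 'I_n].

Lemma card_cycle_arcs n : #|cycle_arcs n| = n.
Proof. by rewrite card_imset ?card_ord // => i j []. Qed.

Lemma ordS_uniq3 n (i : 'I_n) : 2 < n -> uniq [:: i; ordS i; ordS (ordS i)].
Proof.
move=> n3; have ordSneq (j : 'I_n) : j != ordS j.
  have jn := ltn_ord j; rewrite eq_sym -val_eqE /=.
  have [jSn|nj] := ltnP j.+1 n; first by rewrite modn_small // gtn_eqF.
  have -> : j.+1 = n by apply/eqP; rewrite eqn_leq jn.
  (* At the wrap-around [j] is the last vertex and its successor is 0; equality would force [n] to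
     be at most 1. *)
  by rewrite modnn; apply: contraTneq n3 => j0; rewrite -leqNgt (leq_trans nj) // -j0.
rewrite /= !inE negb_or !ordSneq /= !andbT.
rewrite eq_sym -val_eqE /= -addn1 modnDml addn1.
have in_ := ltn_ord i.
(* Writing [i] as [i + 0] modulo [n] lets [i] cancel, which leaves 2 congruent to 0, impossible for
   [n] above 2. *)
have -> : (i.+2 %% n == i) = (i + 2 == i + 0 %[mod n]).
  by rewrite addn2 addn0 (modn_small in_).
by rewrite eqn_modDl mod0n modn_small.
Qed.

Lemma dominating_cycle_complement_weight n (A : digraph 'I_n) f : 2 < n ->
  [disjoint A & cycle_arcs n] -> italian_dominating A f -> 2 < weight f.
Proof.
move=> n3 dis fA; rewrite ltnNge; apply/negP => f2.
have fS i : 0 < f i -> 0 < f (ordS i).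
  rewrite !lt0n => fi; apply/negP => /eqP fSi.
  have iA := dominating_support_arc _ _ _ _ _ fA f2 (etrans (lt0n _) fi) fSi.
  by move/disjointFr/(_ iA): dis; rewrite imset_f.
have [i fi|f0] := pickP [pred i | 0 < f i]; last first.
  (* An empty support would give weight 0. *)
  have: 2 <= weight f by apply: dominating_weight_ge2 fA; rewrite card_ord ltnW.
  by rewrite /weight big1 // => j _; apply/eqP; rewrite -leqn0 leqNgt; apply/negbT/f0.
have: 2 < weight f; last by rewrite ltnNge f2.
have su := ordS_uniq3 _ i n3; set s := [:: _; _; _] in su.
(* Three consecutive vertices of the cycle are distinct and have positive values, so they alone
   contribute 3. *)
apply: (@leq_trans (\sum_(j in s) f j)).
  rewrite -big_uniq // !big_cons big_nil /= addn0.
  by rewrite -[3]/(1 + (1 + 1)) !leq_add ?fS.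
by rewrite /weight [leqRHS](bigID (mem s)) leq_addr.
Qed.

Lemma cycle_arcs_bondage_set n : 2 < n ->
  italian_bondage_set (complete_digraph n) (cycle_arcs n).
Proof.
move=> n3; apply/andP; split.
  apply/subsetP => _ /imsetP[i _ ->]; rewrite inE /=.
  by have := ordS_uniq3 _ i n3; rewrite /= inE negb_or => /andP[/andP[]].
have [f fA ->] := italian_domination_number_witness _
  (complete_digraph n :\: cycle_arcs n).
apply: (@leq_ltn_trans 2).
  (* Every vertex of the complete digraph is spanning; vertex 0 is taken. *)
  apply: (italian_domination_number_spanning _ _ (Ordinal (ltnW (ltnW n3)))).
  by move=> v; rewrite inE eq_sym.
apply: dominating_cycle_complement_weight fA => //.
by rewrite -setI_eq0 setIDAC setDIl setDv setI0.
Qed.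

Theorem theorem3p3 (n : nat) (hn : 3 <= n) :
  italian_bondage_number (complete_digraph n) = Some n.
Proof.
have cyc := cycle_arcs_bondage_set _ hn.
rewrite /italian_bondage_number; case: pickP => [B0 B0P|/(_ (cycle_arcs n))].
  case: arg_minnP => // B BP /(_ _ cyc); rewrite card_cycle_arcs => Bn.
  congr Some; apply/eqP; rewrite eqn_leq Bn.
  by rewrite bondage_set_card_ge ?(ltnW hn).
(* The [None] case is excluded, since the cycle is a bondage set. *)
by rewrite cyc.
Qed.
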